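(* Let $S$ be the set of $\mathcal{P}$-positions of Triangle Game under normal play. Then $$S=\{(a,b,c),(b,c,a),(c,a,b)\mid a,b,c\in\mathbb{Z}_{\ge 0},\ a=b+c,\ b\ge \phi c\},$$ where $\phi=\frac{1+\sqrt{5}}{2}$.
   Context: $\mathbb{Z}_{\ge 0}$ is the set of non-negative integers. Triangle Game is the two-player impartial game with set of positions $M=(\mathbb{Z}_{\ge 0})^3$, where the set of options (positions reachable in one move) of $(x,y,z)\in M$ is $$f((x,y,z))=\{(x-i,y+j,z)\mid 1\le i\le x,\ 0\le j<i\}\cup\{(x,y-i,z+j)\mid 1\le i\le y,\ 0\le j<i\}\cup\{(x+j,y,z-i)\mid 1\le i\le z,\ 0\le j<i\}$$ ($i,j$ integers). The two players alternately move from the current position to one of its options. Each move strictly decreases the total $x+y+z$, so every play is finite; the only terminal position (position with no options) is $(0,0,0)$. Under normal play, the player who makes the last move wins (a player unable to move loses). A position is a $\mathcal{P}$-position if the previous player (the player not about to move) has a winning strategy. Equivalently, under normal play, a position is a $\mathcal{P}$-position if and only if none of its options is a $\mathcal{P}$-position (so terminal positions are $\mathcal{P}$-positions). *)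

(* Defs.v *)
From mathcomp Require Import all_boot all_order all_algebra.
From mathcomp Require Import boolp classical_sets reals.

Set Implicit Arguments.
Unset Strict Implicit.
Unset Printing Implicit Defensive.

Import Order.TTheory GRing.Theory Num.Theory.
Local Open Scope classical_set_scope.

Section NormalPlay.
Variables (T : Type) (f : T -> set T).

(* [s] lists the successive moves (positions reached), starting from [p]. *)
Fixpoint is_play (p : T) (s : seq T) : Prop :=
  if s is q :: s' then f p q /\ is_play q s' else True.

Definition complete_play (p : T) (s : seq T) : Prop :=
  is_play p s /\ f (last p s) = set0.

(* The next player makes the moves of index 0, 2, 4, ... of a play and the
   previous player those of index 1, 3, 5, ...  A strategy of the previous
   player from [p] prescribes, from the moves made so far, a legal move
   whenever it is the previous player's turn and there is one. *)
Definition prev_strategy (p : T) (sigma : seq T -> T) : Prop :=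
  forall s, is_play p s -> odd (size s) -> f (last p s) !=set0 ->
    f (last p s) (sigma s).

Definition prev_follows (p : T) (sigma : seq T -> T) (s : seq T) : Prop :=
  forall k, (k < size s)%N -> odd k -> nth p s k = sigma (take k s).

(* The last move of a complete play is the previous player's, or the next
   player cannot make a first move, exactly when the number of moves is even.
   This is meant for games without infinite plays. *)
Definition prev_winning_strategy (p : T) (sigma : seq T -> T) : Prop :=
  prev_strategy p sigma /\
  forall s, complete_play p s -> prev_follows p sigma s -> ~~ odd (size s).

Definition P_position (p : T) : Prop :=
  exists sigma, prev_winning_strategy p sigma.

End NormalPlay.

Definition position : Type := (nat * nat * nat)%type.

Definition triangle_options (p : position) : set position :=
  let: (x, y, z) := p in
  [set q | exists i j : nat,
     [/\ (1 <= i <= x)%N, (0 <= j < i)%N & q = (x - i, y + j, z)%N]] `|`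
  [set q | exists i j : nat,
     [/\ (1 <= i <= y)%N, (0 <= j < i)%N & q = (x, y - i, z + j)%N]] `|`
  [set q | exists i j : nat,
     [/\ (1 <= i <= z)%N, (0 <= j < i)%N & q = (x + j, y, z - i)%N]].

Definition phi (R : realType) : R := ((1 + Num.sqrt 5) / 2)%R.

(* Main.v *)
Require Import Defs.
From mathcomp Require Import all_boot all_order all_algebra.
From mathcomp Require Import boolp classical_sets reals.
From mathcomp Require Import zify ring lra.

(** The set [S] on the right is a kernel of the game: no option of a position
    of [S] is in [S], and every position outside [S] has an option in [S]; since
    plays are finite, this forces [S] to be the set of P-positions.  For
    naturals, [b >= phi c] means [bc + c^2 <= b^2].

    Outside [S], rotate so that [x] is the largest heap.  If [x < y + z], move to
    [(x, 0, x)].  If [x >= y + z] and [y >= phi z], move to [(y + z, y, z)].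
    Otherwise move to [(y - z, y, z)] when [z <= y], and to [(0, z, z)] when
    [y < z].  That [S] is stable relies on the irrationality of [phi], in the form
    that [c^2 = cd + d^2] has no solution in positive naturals. *)

Local Open Scope classical_set_scope.

Import Order.TTheory GRing.Theory Num.Theory.

Section Kernel.
Variables (T : Type) (f : T -> set T) (m : T -> nat) (S : set T).
Hypothesis f_decr : forall p q, f p q -> (m q < m p)%N.
Hypothesis S_stable : forall p q, S p -> f p q -> ~ S q.
Hypothesis S_absorbing : forall p, ~ S p -> exists2 q, f p q & S q.

(** The previous player answers by [g], which returns to [S] from any position outside it and is
    merely legal elsewhere. The play is then in [S] after every even number of moves, and it cannot
    stop outside [S]. *)
Lemma kernel_P_position p : S p -> P_position f p.
Proof.
have /choice[g gP] x : exists y, f x !=set0 -> f x y /\ (~ S x -> S y).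
  have [Sx|/S_absorbing[y fxy Sy]] := pselect (S x); last by exists y.
  have [[y fxy]|nfx] := pselect (f x !=set0); first by exists y.
  by exists x.
move=> Sp; exists (fun s => g (last p s)); split.
  by move=> s _ _ /gP[].
move=> s; have [n] := ubnP (size s).
elim: n p Sp s => // n IHn p Sp [//|q [|r s]] /= ltn [[fpq play_s] s0] follow_s.
  have [r fqr _] := S_absorbing _ (S_stable _ _ Sp fpq).
  by move: fqr; rewrite s0.
have [fqr play_s'] := play_s.
have Er : r = g q by have := follow_s 1 isT isT.
have Sr : S r.
  rewrite Er; have [|_] := gP q; first by exists r.
  by apply; exact: S_stable Sp fpq.
rewrite negbK; apply: (IHn r Sr s) => //; first by lia.
move=> k ltks oddk; have := follow_s k.+2; rewrite /= negbK => <- //.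
exact: set_nth_default.
Qed.

(** The next player beats any [sigma] by always moving into [S], which [sigma] can only leave again;
    [m] decreases, so this ends. *)
Lemma not_kernel_play p sigma : ~ S p -> prev_strategy f p sigma ->
  exists s, [/\ complete_play f p s, prev_follows p sigma s & odd (size s)].
Proof.
have [n] := ubnP (m p); elim: n p sigma => // n IHn p sigma ltn nSp sigmaP.
have [q fpq Sq] := S_absorbing _ nSp.
have [fq0|nfq0] := pselect (f q = set0).
  by exists [:: q]; split=> // -[].
have fqr : f q (sigma [:: q]) by apply: (sigmaP [:: q]) => //; apply/set0P/eqP.
set r := sigma [:: q] in fqr.
(* What [sigma] prescribes after the moves [q] and [r] is again a strategy, now from [r]. *)
have [|||s [[play_s s0] follow_s odd_s]] :=
    IHn r (fun s => sigma (q :: r :: s)).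
- by have := f_decr _ _ fpq; have := f_decr _ _ fqr; lia.
- exact: S_stable Sq fqr.
- by move=> s play_s odd_s /=; apply: (sigmaP (q :: r :: s)); rewrite //= negbK.
exists (q :: r :: s); split=> //=; last by rewrite negbK.
move=> [|[|k]] //=; rewrite negbK => ltks oddk.
by rewrite -follow_s //; exact: set_nth_default.
Qed.

Lemma P_position_kernel p : P_position f p <-> S p.
Proof.
split; last exact: kernel_P_position.
move=> [sigma [sigmaP win]]; apply: contrapT => nSp.
have [s [cs fs]] := not_kernel_play _ _ nSp sigmaP.
by apply/negP/win.
Qed.

End Kernel.

Definition golden (b c : nat) : bool := (b * c + c * c <= b * b)%N.

(** Factor [b^2 - bc - c^2] as [(b - phi c) (b + (phi - 1) c)]: the second factor is nonnegative,
    and positive once [c > 0]. *)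
Lemma golden_phi (R : realType) (b c : nat) :
  (phi R * c%:R <= b%:R)%R = golden b c.
Proof.
have -> : golden b c = (b%:R * c%:R + c%:R * c%:R <= b%:R * b%:R :> R)%R.
  by rewrite /golden -!natrM -natrD ler_nat.
rewrite /phi.
have b0 := ler0n R b; have c0 := ler0n R c.
have s0 := sqrtr_ge0 (5 : R)%R.
have s2 : (Num.sqrt 5 * Num.sqrt 5 = 5 :> R)%R.
  by rewrite -expr2 sqr_sqrtr.
move: (Num.sqrt _) (b%:R)%R (c%:R)%R s0 s2 b0 c0 => s x y s0 s2 x0 y0.
have s1 : (1 < s)%R by nra.
have E : ((x - (1 + s) / 2 * y) * (x + (s - 1) / 2 * y) =
          x * x - (x * y + y * y))%R.
  have -> : (x * x - (x * y + y * y) =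
             x * x - x * y - (s * s - 1) / 4 * (y * y))%R by rewrite s2; field.
  by field.
rewrite -subr_ge0 -[RHS]subr_ge0 -E.
apply/idP/idP => h.
  by rewrite mulr_ge0 // addr_ge0 // mulr_ge0 //; lra.
rewrite leNgt; apply/negP => lt0.
have y_gt0 : (0 < y)%R.
  by rewrite lt_def y0 andbT; apply/eqP => ey; move: lt0; rewrite ey; lra.
have pos : (0 < x + (s - 1) / 2 * y)%R.
  by rewrite ltr_wpDl // mulr_gt0 //; lra.
by move: h; rewrite leNgt nmulr_rlt0 // pos.
Qed.

(** Infinite descent: a solution [(c, d)] with [d > 0] yields the solution [(d, c - d)], whose first
    component is smaller. *)
Lemma golden_eq0 (c d : nat) : (c * c = c * d + d * d)%N -> c = 0%N.
Proof.
have [n] := ubnP c; elim: n c d => // n IHn c d ltcn e.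
have [d0|d_gt0] := posnP d; first by nia.
have ltdc : (d < c)%N by nia.
by have := IHn d (c - d)%N; nia.
Qed.

Definition kernel (p : position) : Prop := let: (x, y, z) := p in
  [\/ x = (y + z)%N /\ golden y z,
      z = (x + y)%N /\ golden x y |
      y = (z + x)%N /\ golden z x].

Definition rot (p : position) : position := let: (x, y, z) := p in (y, z, x).

Lemma kernel_rot p : kernel (rot p) <-> kernel p.
Proof.
by case: p => [[x y] z]; split=> -[] h;
  first [exact: Or31 h | exact: Or32 h | exact: Or33 h].
Qed.

Lemma options_rot p q :
  triangle_options p q <-> triangle_options (rot p) (rot q).
Proof.
case: p q => [[x y] z] [[x' y'] z'].
split; move=> [[|]|] [i [j [hi hj [-> -> ->]]]].
- by right; exists i, j.
- by left; left; exists i, j.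
- by left; right; exists i, j.
- by left; right; exists i, j.
- by right; exists i, j.
- by left; left; exists i, j.
Qed.

Lemma options_decr (p q : position) : triangle_options p q ->
  (q.1.1 + q.1.2 + q.2 < p.1.1 + p.1.2 + p.2)%N.
Proof.
by case: p => [[x y] z] [[|]|] [i [j [hi hj ->]]] /=; lia.
Qed.

Lemma kernel_stable1 y z q : golden y z ->
  triangle_options ((y + z)%N, y, z) q -> ~ kernel q.
Proof.
move=> gyz; have ltzy : (z < y)%N || (y + z == 0)%N by move: gyz; rewrite /golden; nia.
move=> [[|]|] [i [j [hi hj ->]]] /= [] [e g]; try by lia.
(* The one case left is a move from the first heap to [(u, y + j, z)] with [y + j = z + u], so
   [u = d + j] where [d = y - z]. Then [golden y z] reads [z^2 <= zd + d^2] and [golden z u] reads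
   [zu + u^2 <= z^2]; as [d <= u], equality holds throughout. *)
have ez : (z = 0)%N.
  apply: (golden_eq0 z (y - z)).
  have := leq_add (leq_mul (leqnn z) (leq_addr j (y - z)))
    (leq_mul (leq_addr j (y - z)) (leq_addr j (y - z))).
  have -> : (y - z + j)%N = (y + z - i)%N by lia.
  have ey : y = (z + (y - z))%N by lia.
  move: gyz g; rewrite /golden; move: (y + z - i)%N => u.
  by rewrite ey addKn; nia.
by lia.
Qed.

Lemma kernel_stable p q : kernel p -> triangle_options p q -> ~ kernel q.
Proof.
case: p => [[x y] z] [] [-> g].
- exact: kernel_stable1.
- move=> /options_rot /options_rot h; rewrite -kernel_rot -kernel_rot.
  exact: kernel_stable1 h.
- move=> /options_rot h; rewrite -kernel_rot.
  exact: kernel_stable1 h.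
Qed.

Lemma kernel_absorbing_max x y z : (y <= x)%N -> (z <= x)%N ->
  ~ kernel (x, y, z) -> exists2 q, triangle_options (x, y, z) q & kernel q.
Proof.
move=> leyx lezx nS.
have [ltx|lex] := ltnP x (y + z).
  exists (x, 0, x)%N; last by constructor 2; rewrite addn0 /golden; lia.
  (* Empty the second heap; the bound [j < i] is [x - z < y]. *)
  by left; right; exists y, (x - z)%N; split; [lia | lia | congr (_, _, _); lia].
have [g|ng] := boolP (golden y z).
  exists ((y + z)%N, y, z); last by constructor 1.
  have nx : x <> (y + z)%N by move=> ex; apply: nS; constructor 1.
  left; left; exists (x - (y + z))%N, 0%N.
  by split; [lia | lia | congr (_, _, _); lia].
have [lezy|ltyz] := leqP z y.
  exists ((y - z)%N, y, z).
    left; left; exists (x - (y - z))%N, 0%N.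
    have z0 : (0 < z)%N by move: ng; rewrite /golden; nia.
    by split; [lia | lia | congr (_, _, _); lia].
  constructor 3; split; first by lia.
  (* With [y = z + d], failure of [golden y z] reads [zd + d^2 < z^2], which gives [golden z d]. *)
  have ey : y = (z + (y - z))%N by lia.
  by move: ng; rewrite /golden {1 2 3}ey; nia.
exists (0%N, z, z); last by constructor 3; rewrite addn0 /golden; lia.
(* Emptying the first heap may add [z - y] to the second only if [z - y < x]. Otherwise [z <= x]
   forces [y = 0] and [z = x], a kernel position. *)
have ltz : (z < x + y)%N.
  rewrite ltnNge; apply/negP => le; apply: nS; constructor 2.
  by split; [lia | rewrite /golden; nia].
left; left; exists x, (z - y)%N.
by split; [lia | lia | congr (_, _, _); lia].
Qed.

Lemma kernel_absorbing p :
  ~ kernel p -> exists2 q, triangle_options p q & kernel q.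
Proof.
case: p => [[x y] z] nS.
have [/andP[]|hx] := boolP ((y <= x)%N && (z <= x)%N).
  by move=> *; exact: kernel_absorbing_max.
have [/andP[le1 le2]|hy] := boolP ((z <= y)%N && (x <= y)%N).
  have [|[[a b] c] hq Sq] := kernel_absorbing_max y z x le1 le2.
    by move/(kernel_rot (x, y, z)).
  exists (c, a, b); last exact/kernel_rot.
  exact/options_rot.
have [|||[[a b] c] hq Sq] := kernel_absorbing_max z x y; try lia.
  by move/(kernel_rot (y, z, x))/(kernel_rot (x, y, z)).
(* Two rotations take [(b, c, a)] to [(a, b, c)], as they take [(x, y, z)] to [(z, x, y)]. *)
exists (b, c, a); last by rewrite -kernel_rot -kernel_rot.
by rewrite options_rot options_rot.
Qed.

Local Open Scope ring_scope.

Theorem theorem2p4 (R : realType) :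
  [set p : position | P_position triangle_options p] =
  [set p : position | exists a b c : nat,
     [/\ a = (b + c)%N, b%:R >= phi R * c%:R &
         p = (a, b, c) \/ p = (b, c, a) \/ p = (c, a, b)]].
Proof.
apply/seteqP; split=> p /=.
  move=> /(P_position_kernel _ _ _ _ options_decr kernel_stable kernel_absorbing).
  case: p => [[x y] z] [] [e g].
  - by exists x, y, z; rewrite golden_phi; split=> //; left.
  - by exists z, x, y; rewrite golden_phi; split=> //; right; left.
  - by exists y, z, x; rewrite golden_phi; split=> //; right; right.
move=> [a [b [c [e g hp]]]].
apply/(P_position_kernel _ _ _ _ options_decr kernel_stable kernel_absorbing).
rewrite golden_phi in g.
case: hp => [|[]] ->; [exact: Or31 | exact: Or32 | exact: Or33].
Qed.
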